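(* Let $n=2m+1\ge 7$ be odd, let $V$ be as described in the context, and let $Z$ be standard normal. Then $$\sup_{z\in\mathbb{R}}\left|P\left(\frac{V-n/2}{\sigma_V}\le z\right)-P(Z\le z)\right|\le\frac{n}{2\sigma_V^2}\overline{\Delta}_1+1.64\frac{n}{\sigma_V^3}+\frac{2}{\sigma_V},$$ where $\sigma_V^2=\frac n4(1-\overline{\lambda}_{n,2,\mathbf{n}})+\frac{n^2}{4}\overline{\lambda}_{n,2,\mathbf{n}}$ and $\overline{\Delta}_1=\frac{1}{\sqrt n}+\frac{1}{2\sqrt2}e^{-n/4}$.
   Context: Standard lightbulb process: $n$ bulbs, all initially off, $n$ stages; at stage $r$ a uniformly random subset of exactly $r$ bulbs is toggled, independently across stages; switch variables $X_{rj}\in\{0,1\}$ ($1$ iff bulb $j$ toggled at stage $r$). For $n=2m+1$: given $\mathbf{X}$, let $B_m$ be uniform on $\{j:X_{mj}=0\}$ and $B_{m+1}$ uniform on $\{j:X_{m+1,j}=1\}$; let $C_m,C_{m+1}$ be independent symmetric Bernoulli variables independent of $\mathbf{X},B_m,B_{m+1}$; set $V_{rj}=X_{rj}$ except $V_{m,B_m}=C_m$ and $V_{m+1,B_{m+1}}=C_{m+1}$; $V_j=(\sum_{r=1}^nV_{rj})\bmod 2$, $V=\sum_{j=1}^nV_j$. With $(n)_t=n(n-1)\cdots(n-t+1)$, $\lambda_{n,b,s}=\sum_{t=0}^b\binom bt(-2)^t\frac{(s)_t}{(n)_t}$, and $\overline{\lambda}_{n,2,\mathbf{n}}=\Big(\prod_{s\in\{1,\dots,n\}\setminus\{m,m+1\}}\lambda_{n,2,s}\Big)\Big(\tfrac12(\lambda_{n,2,m}+\lambda_{n,2,m+1})\Big)^2$.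 *)

(* Defs.v *)
From HB Require Import structures.
From mathcomp Require Import all_boot all_order all_algebra.
From mathcomp Require Import all_classical all_reals all_analysis.
Set Implicit Arguments. Unset Strict Implicit. Unset Printing Implicit Defensive.
Import Order.TTheory GRing.Theory Num.Theory.
Local Open Scope ring_scope.

(* Bulbs are indexed by 'I_n (bulb j+1 of the paper = j).  Stages are indexed
   by 'I_n.+1 : stage r (1 <= r <= n) of the paper is r; the extra stage 0
   toggles exactly 0 bulbs, i.e. is the empty set with probability 1, and is
   therefore harmless. *)

(* Sample space for the modified lightbulb process with n = 2m+1:
   (X, B_m, B_{m+1}, C_m, C_{m+1}) where X r = set of bulbs toggled at stage r. *)
Definition omega (m : nat) : finType :=
  ({ffun 'I_(2 * m + 1).+1 -> {set 'I_(2 * m + 1)}} * 'I_(2 * m + 1) * 'I_(2 * m + 1) * bool * bool)%type.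

(* probability weight of an outcome:
   independent stages, stage r uniform on the r-subsets of the n bulbs;
   given X, B_m uniform on {j : X_{mj} = 0} (size n-m), B_{m+1} uniform on
   {j : X_{m+1,j} = 1} (size m+1); C_m, C_{m+1} independent fair coins. *)
Definition weight {R : realType} (m : nat) (w : omega m) : R :=
  let: (X, bm, bm1, cm, cm1) := w in
  let n := (2 * m + 1)%N in
  (\prod_(r : 'I_n.+1) ((#|X r| == r)%:R / ('C(n, r))%:R)) *
  ((bm \notin X (inord m))%:R / (n - m)%:R) *
  ((bm1 \in X (inord m.+1))%:R / (m.+1)%:R) *
  (1 / 4).

Definition Vrj (m : nat) (w : omega m) (r : 'I_(2 * m + 1).+1) (j : 'I_(2 * m + 1)) : bool :=
  let: (X, bm, bm1, cm, cm1) := w in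
  if (val r == m) && (j == bm) then cm
  else if (val r == m.+1) && (j == bm1) then cm1
  else j \in X r.

Definition Vj (m : nat) (w : omega m) (j : 'I_(2 * m + 1)) : nat :=
  ((\sum_(r : 'I_(2 * m + 1).+1) (Vrj w r j : nat)) %% 2)%N.

Definition Vtot (m : nat) (w : omega m) : nat := (\sum_(j : 'I_(2 * m + 1)) Vj w j)%N.

Definition Prob {R : realType} (m : nat) (E : pred (omega m)) : R :=
  \sum_(w : omega m | E w) weight w.

Definition lam {R : realType} (n b s : nat) : R :=
  \sum_(t < b.+1) ('C(b, t))%:R * (-2) ^+ t * (s ^_ t)%:R / (n ^_ t)%:R.

Definition lambar {R : realType} (m : nat) : R :=
  let n := (2 * m + 1)%N in
  (\prod_(1 <= s < n.+1 | (s != m) && (s != m.+1)) lam n 2 s) *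
  ((lam n 2 m + lam n 2 m.+1) / 2) ^+ 2.

Definition sigmaV2 {R : realType} (m : nat) : R :=
  let n := (2 * m + 1)%:R in
  n / 4 * (1 - lambar m) + n ^+ 2 / 4 * lambar m.

Definition Delta1 {R : realType} (m : nat) : R :=
  let n := (2 * m + 1)%:R in
  1 / Num.sqrt n + 1 / (2 * Num.sqrt 2) * expR (- n / 4).

Definition Phi {R : realType} (z : R) : R :=
  fine (normal_prob 0 1 `]-oo, z]%classic).

(* Main.v *)
(* The bulb vector is the mod-2 sum of the independent stage sets. After the
   modification, stages m and m+1 are each uniform on the two middle layers of
   the cube, so the Walsh coefficient of V at S is at most lambda_S^2 in absolute
   value, where lambda_S is the coefficient of the uniform law on these two
   layers. Reciprocity of Krawtchouk polynomials shows that lambda_S = 0 for odd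
   |S| and |lambda_S| = C(m,j)/C(n,2j) for |S| = 2j, and Parseval makes the law of
   the bulb vector O(n^(-1/2))-close in total variation to the uniform law; V is
   then compared with a Binomial(n,1/2) variable.

   For the binomial, the identity E[(2S-n) g(S)] = E[(n-S)(g(S+1)-g(S))] applied
   to the solution of Stein's equation for the indicator of (-oo, z] gives the
   normal approximation. When z is a lattice point the kink of the solution never
   lies inside a step [w, w + 1/sigma], so a second-order Taylor expansion is
   available on every step. Finally lambda_{n,2,m} = lambda_{n,2,m+1} = -1/n,
   whence (n-1)/4 <= sigma_V^2 <= (n+1)/4, and the last two terms of the bound
   already dominate both errors. *)
Require Import Defs.
From HB Require Import structures.
From mathcomp Require Import all_boot all_order all_algebra.
From mathcomp Require Import all_classical all_reals all_analysis.
Import Order.TTheory GRing.Theory Num.Theory.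
From mathcomp Require Import ring lra zify.
Local Open Scope ring_scope.
Import numFieldNormedType.Exports.
Set Implicit Arguments. Unset Strict Implicit. Unset Printing Implicit Defensive.

(** * The normal distribution function *)

Section mean_value.
Context {R : realType}.
Implicit Types (f df ddf : R -> R) (a b M x : R).

Lemma increment_le f df a b M : (forall x, is_derive x 1 f (df x)) -> a <= b ->
  (forall x, a <= x <= b -> df x <= M) -> f b - f a <= M * (b - a).
Proof.
move=> fdf ab dfM.
have cf : {within `[a, b], continuous f}%classic.
  by apply: derivable_within_continuous => y _; apply: ex_derive.
have [c] := @MVT_segment R f df a b ab (fun x _ => fdf x) cf.
rewrite in_itv/= => cab ->.
by rewrite ler_wpM2r ?subr_ge0// dfM.
Qed.

(** The mean value inequality is used twice: on [df] it gives [df x - df a <= M * (x - a)], and this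
    makes the auxiliary function [h] nonincreasing on [a, b]. *)
Lemma taylor2_le f df ddf a b M :
  (forall x, is_derive x 1 f (df x)) -> (forall x, is_derive x 1 df (ddf x)) ->
  a <= b -> (forall x, a <= x <= b -> ddf x <= M) ->
  f b - f a - (b - a) * df a <= M * (b - a) ^+ 2 / 2.
Proof.
move=> fdf dfddf ab ddfM.
pose h x := f x - x * df a - M / 2 * (x - a) ^+ 2.
pose dh x := df x - df a - M * (x - a).
have hdh x : is_derive x 1 h (dh x).
  rewrite /h /dh; apply: is_derive_eq.
  by rewrite /GRing.scale /=; field.
have := @increment_le h dh a b 0 hdh ab.
rewrite mul0r /h /dh => H; suff : f b - b * df a - M / 2 * (b - a) ^+ 2 -
  (f a - a * df a - M / 2 * (a - a) ^+ 2) <= 0 by lra.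
apply: H => x /andP[ax xb]; rewrite subr_le0.
apply: increment_le => // y /andP[ay yx]; apply: ddfM.
by rewrite ay (le_trans yx).
Qed.

Lemma taylor2_abs_le f df ddf a b M :
  (forall x, is_derive x 1 f (df x)) -> (forall x, is_derive x 1 df (ddf x)) ->
  a <= b -> (forall x, a <= x <= b -> `|ddf x| <= M) ->
  `|f b - f a - (b - a) * df a| <= M * (b - a) ^+ 2 / 2.
Proof.
move=> fdf dfddf ab ddfM; rewrite ler_norml; apply/andP; split; last first.
  by apply: taylor2_le ab _ => // x /ddfM; rewrite ler_norml => /andP[].
have dN (g dg : R -> R) : (forall x, is_derive x 1 g (dg x)) ->
    forall x, is_derive x 1 (- g) (- dg x).
  by move=> gdg x; apply: is_deriveN.
have := @taylor2_le (- f) (- df) (- ddf) a b M (dN _ _ fdf) (dN _ _ dfddf) ab.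
have E (g : R -> R) x : (- g) x = - g x by [].
rewrite !E => H; rewrite lerNl; suff : - f b - - f a - (b - a) * - df a <=
  M * (b - a) ^+ 2 / 2 by lra.
apply: H => x /ddfM; rewrite E ler_norml => /andP[+ _].
by rewrite lerNl.
Qed.

End mean_value.

(** * Density and distribution function of the standard normal law *)

Section normal.
Context {R : realType}.
Implicit Types x y z w t : R.

Definition phi : R -> R := normal_pdf 0 1.

Lemma phiE x : phi x = normal_peak 1 * expR (- (x ^+ 2 / 2)).
Proof.
rewrite /phi normal_pdfE ?oner_eq0// /normal_fun subr0 expr1n.
by rewrite mulNr.
Qed.

Lemma phi_gt0 x : 0 < phi x.
Proof. by rewrite phiE mulr_gt0 ?expR_gt0// normal_peak_gt0 ?oner_eq0. Qed.

Lemma phi_le_half x : phi x <= 2^-1.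
Proof.
apply: (le_trans (normal_pdf_ub _ _ _)); first exact: oner_neq0.
rewrite /normal_peak lef_pV2 ?posrE//; last first.
  by rewrite sqrtr_gt0 expr1n mul1r mulrn_wgt0// pi_gt0.
rewrite -[leLHS](@ger0_norm _ 2)// -sqrtr_sqr ler_wsqrtr//.
by have := @pi_ge2 R; rewrite expr1n mul1r -mulr_natl; lra.
Qed.

(* The constant comes from [2 pi <= 9] and [exp (- 1/2) >= 1 - 1/2]. *)
Lemma phi_ge_sixth x : `|x| <= 1 -> 6^-1 <= phi x.
Proof.
move=> x1; rewrite phiE.
have x2 : x ^+ 2 <= 1 by rewrite -real_normK ?num_real// expr_le1.
have e1 : 2^-1 <= expR (- (x ^+ 2 / 2)).
  apply: (le_trans _ (expR_ge1Dx _)).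
  lra.
have e2 : 3^-1 <= @normal_peak R 1.
  rewrite /normal_peak lef_pV2 ?posrE//; last first.
    by rewrite sqrtr_gt0 expr1n mul1r mulrn_wgt0// pi_gt0.
  rewrite -[leRHS](@ger0_norm _ 3)// -sqrtr_sqr ler_wsqrtr//.
  have := @pihalf_02_cos_pihalf R => -[/andP[_ +] _].
  rewrite expr1n mul1r -mulr_natl; lra.
have -> : (6^-1 : R) = 3^-1 * 2^-1 by field.
by rewrite ler_pM.
Qed.

Lemma is_derive_phi x : is_derive x 1 phi (- x * phi x).
Proof.
have -> : phi = fun x => normal_peak 1 * expR (- (x ^+ 2 / 2)).
  by apply/funext => y; rewrite phiE.
apply: is_derive_eq.
by rewrite /GRing.scale /=; field.
Qed.

Lemma is_derive_Phi x : is_derive x 1 Phi (phi x).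
Proof.
(* Fundamental theorem of calculus with left endpoint -oo; [x + 1] only places [x] in the interior
   of the domain. *)
have := @continuous_FTC1 R (phi) (BInfty _ true) x (x + 1).
rewrite ltrDl ltr01 => /(_ isT) [].
- apply: (@integrableS _ _ _ _ setT) => //.
  exact: integrable_normal_pdf.
- by rewrite ltNyr.
- by apply: continuous_normal_pdf; rewrite oner_eq0.
- move=> dF dE; apply: DeriveDef; first exact: dF.
  by rewrite -derive1E; exact: dE.
Qed.

Lemma Phi_ge0 x : 0 <= Phi x.
Proof. by rewrite /Phi fine_ge0. Qed.

Lemma Phi_le1 x : Phi x <= 1.
Proof.
rewrite /Phi; have : (normal_prob (0 : R) 1 `]-oo, x]%classic <= 1%E)%E.
  by rewrite probability_le1.
have : (0%E <= normal_prob (0 : R) 1 `]-oo, x]%classic)%E by [].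
by case: (normal_prob _ _ _).
Qed.

(** The identity seen as a random variable under the normal law: its [cdf] is [Phi], so the limits
    of distribution functions at -oo and +oo apply. *)
Let idTR : measurableTypeR R -> R := idfun.

#[local] HB.instance Definition _ :=
  @isMeasurableFun.Build _ _ _ _ idTR (@measurable_id _ _ setT).

Let cdf_Phi : fine \o cdf (idTR : {RV (normal_prob 0 1) >-> R}) = Phi.
Proof.
by apply/funext => t; rewrite /= /cdf/= /distribution/= /pushforward preimage_id.
Qed.

Lemma Phi_small (e : R) w : 0 < e -> exists2 t, t < w & Phi t < e.
Proof.
move=> e0.
have /fine_cvgP[_ H] := @cvg_cdfNy0 _ _ R (normal_prob 0 1) idTR.
have : \forall t \near -oo, Phi t < e.
  rewrite cdf_Phi in H.
  by move/cvgr_lt : H => /(_ e e0).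
move=> /= [M [_ HM]].
exists (Num.min (w - 1) (M - 1)); last apply: HM; rewrite gt_min.
  by apply/orP; left; lra.
by apply/orP; right; lra.
Qed.

Lemma Phi_near1 (e : R) w : 0 < e -> exists2 t, w < t & 1 - Phi t < e.
Proof.
move=> e0.
have /fine_cvgP[_ H] := @cvg_cdfy1 _ _ R (normal_prob 0 1) idTR.
have : \forall t \near +oo, 1 - e < Phi t.
  have e1 : 1 - e < 1 by lra.
  rewrite cdf_Phi in H.
  by move/cvgr_gt : H => /(_ (1 - e) e1).
move=> /= [M [_ HM]].
have := HM (Num.max (w + 1) (M + 1)); rewrite /= lt_max.
have -> : (M < M + 1) by lra.
rewrite orbT => /(_ isT) He.
exists (Num.max (w + 1) (M + 1)); last by lra.
by rewrite lt_max; apply/orP; left; lra.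
Qed.

Lemma Phi_lipschitz x y : x <= y -> 0 <= Phi y - Phi x <= (y - x) / 2.
Proof.
move=> xy; apply/andP; split.
  rewrite subr_ge0.
  have := @increment_le R (- Phi) (- phi) x y 0.
  rewrite mul0r /GRing.opp/= -!/(GRing.opp _) => H.
  suff : - Phi y - - Phi x <= 0 by lra.
  apply: H => // [t|t _]; first exact/is_deriveN/is_derive_Phi.
  by rewrite oppr_le0 ltW// phi_gt0.
rewrite mulrC; apply: increment_le xy _ => [t|t _]; first exact: is_derive_Phi.
exact: phi_le_half.
Qed.

Lemma Phi_mono x y : x <= y -> Phi x <= Phi y.
Proof. by move=> /Phi_lipschitz/andP[]; rewrite subr_ge0. Qed.

End normal.

(** * Stein's equation *)

Section stein_solution.
Context {R : realType}.
Implicit Types a b d e w x z : R.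

(* [phi + w * Phi] has derivative [(w - x) * phi x], so it is nondecreasing
   on the left of [w]; at -oo it vanishes. *)
Lemma mills_left w : - w * Phi w <= phi w.
Proof.
have [w0|w0] := leP 0 w.
  by rewrite (le_trans _ (ltW (phi_gt0 w)))// mulNr oppr_le0 mulr_ge0// Phi_ge0.
apply/ler_addgt0Pr => e e0.
have [t tw Pt] := @Phi_small R (e / - w) w (ltac:(by rewrite divr_gt0// oppr_gt0)).
pose K x := - phi x - w * Phi x.
have dK x : is_derive x 1 K (x * phi x - w * phi x).
  have dphi := is_derive_phi x; have dPhi := is_derive_Phi x.
  by apply: is_derive_eq; rewrite /GRing.scale /=; ring.
have := @increment_le R K _ t w 0 dK (ltW tw); rewrite mul0r.
have dK0 x : t <= x <= w -> x * phi x - w * phi x <= 0.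
  move=> /andP[_ xw].
  by rewrite -mulrBl mulr_le0_ge0 ?subr_le0// ltW// phi_gt0.
move=> /(_ dK0).
rewrite ltr_pdivlMr ?oppr_gt0// in Pt.
rewrite /K => H; have := phi_gt0 t; lra.
Qed.

(** On the right of [w > 0], [phi x - w * (1 - Phi x)] has derivative [(w - x) * phi x], so it is
    nonincreasing; it vanishes at +oo. *)
Lemma mills_right w : w * (1 - Phi w) <= phi w.
Proof.
have [w0|w0] := leP w 0.
  rewrite (le_trans _ (ltW (phi_gt0 w)))// mulr_le0_ge0// subr_ge0.
  exact: Phi_le1.
apply/ler_addgt0Pr => e e0.
have [t tw Pt] := @Phi_near1 R (e / w) w (divr_gt0 e0 w0).
pose K x := phi x - w * (1 - Phi x).
have dK x : is_derive x 1 K (w * phi x - x * phi x).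
  have dphi := is_derive_phi x; have dPhi := is_derive_Phi x.
  by apply: is_derive_eq; rewrite /GRing.scale /=; ring.
have := @increment_le R K _ w t 0 dK (ltW tw); rewrite mul0r.
have dK0 x : w <= x <= t -> w * phi x - x * phi x <= 0.
  move=> /andP[wx _].
  by rewrite -mulrBl mulr_le0_ge0 ?subr_le0// ltW// phi_gt0.
move=> /(_ dK0).
rewrite ltr_pdivlMr// in Pt.
rewrite /K => H; have := phi_gt0 t; lra.
Qed.

(** The bounded solution of Stein's equation f'(w) - w f(w) = 1_{w <= z} - Phi(z) for w != z; the
    minimum and maximum merge its two branches. *)
Definition stein_sol z w : R :=
  Phi (Num.min w z) * (1 - Phi (Num.max w z)) / phi w.

Lemma stein_sol_ge0 z w : 0 <= stein_sol z w.
Proof.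
rewrite /stein_sol divr_ge0 ?(ltW (phi_gt0 _))// mulr_ge0 ?Phi_ge0//.
by rewrite subr_ge0 Phi_le1.
Qed.

Lemma stein_sol_phi_le z w :
  stein_sol z w * phi w <= Phi w * (1 - Phi w).
Proof.
rewrite /stein_sol divfK ?gt_eqF ?phi_gt0//.
rewrite ler_pM ?Phi_ge0 ?subr_ge0 ?Phi_le1// ?lerB// ?Phi_mono//.
  by rewrite ge_min lexx.
by rewrite le_max lexx.
Qed.

(** For |w| <= 1 the quotient of Phi (1 - Phi) <= 1/4 by phi >= 1/6 is at most 3/2; for |w| > 1
    Mills' inequalities give even 1. *)
Lemma stein_sol_le z w : stein_sol z w <= 3 / 2.
Proof.
have f0 := stein_sol_ge0 z w; have H := stein_sol_phi_le z w.
have P4 : Phi w * (1 - Phi w) <= 4^-1 by have := sqr_ge0 (Phi w - 2^-1); nra.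
have [w1|w1] := leP `|w| 1.
  by have := ler_wpM2l f0 (phi_ge_sixth w1); lra.
have P0 := Phi_ge0 w; have P1 := Phi_le1 w; have p0 := phi_gt0 w.
suff : stein_sol z w * phi w <= 1 * phi w by rewrite ler_pM2r//; lra.
apply: (le_trans H).
have [w0|w0] := leP 0 w.
  have := mills_right w; rewrite ger0_norm// in w1; nra.
have := mills_left w; rewrite ltr0_norm// in w1; nra.
Qed.

Lemma mul_stein_sol_le z w : `|w * stein_sol z w| <= 1.
Proof.
have f0 := stein_sol_ge0 z w; have H := stein_sol_phi_le z w.
have P0 := Phi_ge0 w; have P1 := Phi_le1 w; have p0 := phi_gt0 w.
rewrite normrM (ger0_norm f0).
suff : `|w| * stein_sol z w * phi w <= 1 * phi w by rewrite ler_pM2r.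
rewrite mul1r -mulrA; apply: (le_trans (ler_wpM2l (normr_ge0 w) H)).
have [w0|w0] := leP 0 w.
  rewrite ger0_norm// mulrCA; apply: le_trans (mills_right w).
  by rewrite ler_piMl// mulr_ge0// subr_ge0.
rewrite ltr0_norm// mulrA; apply: le_trans (mills_left w).
by rewrite ler_piMr// ?gerBl// mulr_ge0// oppr_ge0 ltW.
Qed.

(** Both branches of [stein_sol z] have this shape: (a, b) is (0, 1 - Phi z) on the left of z and
    (Phi z, - Phi z) on the right. Each branch is smooth on the whole line. *)
Lemma is_derive_stein_branch a b x :
  is_derive x 1 (fun w => (a + b * Phi w) / phi w)
    (b + x * ((a + b * Phi x) / phi x)).
Proof.
have dphi := is_derive_phi x; have dPhi := is_derive_Phi x.
have px : phi x != 0 by rewrite gt_eqF// phi_gt0.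
have dV := is_deriveV px dphi.
apply: is_derive_eq.
by rewrite /GRing.scale /=; field.
Qed.

(** The second derivative of the branch F is F + x (b + x F); the bounds 3/2 on F and 1 on |x F|
    make it at most 3/2 + 2 |x| on the step. *)
Lemma stein_branch_step a b z w d : 0 <= d -> `|b| <= 1 ->
  (forall x, w <= x <= w + d -> stein_sol z x = (a + b * Phi x) / phi x) ->
  `|stein_sol z (w + d) - stein_sol z w - d * (b + w * stein_sol z w)| <=
    (3 / 2 + 2 * (`|w| + d)) * d ^+ 2 / 2.
Proof.
move=> d0 b1 fE.
pose F x := (a + b * Phi x) / phi x.
pose dF x := b + x * F x.
have FdF x : is_derive x 1 F (dF x) by exact: is_derive_stein_branch.
have dFddF x : is_derive x 1 dF (F x + x * dF x).
  by apply: is_derive_eq; rewrite /GRing.scale /=; ring.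
have := @taylor2_abs_le R F dF _ w (w + d) (3 / 2 + 2 * (`|w| + d)) FdF dFddF.
have -> : w + d - w = d by ring.
rewrite lerDl => /(_ d0).
have FE x : w <= x <= w + d -> F x = stein_sol z x by move=> /fE.
rewrite /dF !FE ?lexx ?lerDl ?d0//; apply => x xwd.
rewrite FE//.
have := stein_sol_le z x; have := stein_sol_ge0 z x => f0 f32.
apply: (le_trans (ler_normD _ _)); rewrite (ger0_norm f0) lerD// normrM mulrC.
rewrite ler_pM//.
  apply: (le_trans (ler_normD _ _)).
  by have := mul_stein_sol_le z x; lra.
have /andP[wx xd] := xwd.
by rewrite ler_norml; apply/andP; split; have := ler_norm w; have := ler_norm (- w);
  rewrite normrN; lra.
Qed.

Lemma stein_sol_step z w d : 0 <= d -> w + d <= z \/ z <= w ->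
  `|stein_sol z (w + d) - stein_sol z w
     - d * (w * stein_sol z w + (w < z)%R%:R - Phi z)| <=
    (3 / 2 + 2 * (`|w| + d)) * d ^+ 2 / 2.
Proof.
move=> d0; have P0 := Phi_ge0 z; have P1 := Phi_le1 z.
(* With d = 0 the first alternative allows w = z, where the strict indicator belongs to the right
   branch. Both sides are then 0. *)
have [->|dn0] := eqVneq d 0.
  by move=> _; rewrite addr0 subrr !mul0r expr0n/= mulr0 subr0 mul0r normr0.
have dgt0 : 0 < d by rewrite lt_neqAle eq_sym dn0.
case=> wz.
  have -> : w < z by lra.
  have := @stein_branch_step 0 (1 - Phi z) z w d d0.
  have -> : w * stein_sol z w + 1%:R - Phi z = 1 - Phi z + w * stein_sol z w.
    by ring.
  apply; first by rewrite ler_norml; apply/andP; split; lra.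
  move=> x /andP[wx xd]; have xz : x <= z by lra.
  by rewrite /stein_sol min_l// max_r// add0r mulrC [Phi x * _]mulrC mulrC.
have -> : (w < z) = false by lra.
have := @stein_branch_step (Phi z) (- Phi z) z w d d0.
have -> : w * stein_sol z w + 0%:R - Phi z = - Phi z + w * stein_sol z w.
  by ring.
apply; first by rewrite normrN ger0_norm.
move=> x /andP[wx xd]; have xz : z <= x by lra.
by rewrite /stein_sol min_r// max_l// mulrBr mulr1 mulNr.
Qed.

End stein_solution.

(** * Normal approximation of the symmetric binomial law *)

Section fair_coins.
Context {R : realType} {T : finType}.
Local Notation n := #|T|.
Implicit Types (g : nat -> R) (h : {set T} -> R) (s z : R).

Lemma sum_setU1 (b : T) h :
  \sum_(A : {set T} | b \notin A) h (b |: A) = \sum_(A : {set T} | b \in A) h A.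
Proof.
rewrite [RHS](reindex_onto (fun A => b |: A) (fun A => A :\ b)) /=; last first.
  by move=> A bA; rewrite finset.setD1K.
apply: eq_bigl => A; rewrite finset.setU11/=.
apply/idP/eqP => [bA|<-]; first by rewrite finset.setU1K.
by rewrite finset.setD11.
Qed.

Lemma sum_setD1 (b : T) h :
  \sum_(A : {set T} | b \in A) h (A :\ b) = \sum_(A : {set T} | b \notin A) h A.
Proof.
rewrite -sum_setU1; apply: eq_bigr => A bA.
by rewrite finset.setU1K.
Qed.

Lemma sum_mem_mul h :
  \sum_(b : T) \sum_(A : {set T} | b \in A) h A = \sum_(A : {set T}) #|A|%:R * h A.
Proof.
rewrite (exchange_big_dep xpredT)//=; apply: eq_bigr => A _.
by rewrite sumr_const mulr_natl.
Qed.

Lemma sum_notin_mul h :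
  \sum_(b : T) \sum_(A : {set T} | b \notin A) h A =
  \sum_(A : {set T}) (n - #|A|)%:R * h A.
Proof.
rewrite (exchange_big_dep xpredT)//=; apply: eq_bigr => A _.
rewrite sumr_const mulr_natl; congr (_ *+ _).
by rewrite -(cardsC A) addKn; apply: eq_card => j; rewrite !inE.
Qed.

(** Pairs (b, A) with b in A correspond to pairs (b, A) with b outside A by removing b; on the
    second kind the size is one less. *)
Lemma sum_card_mul g :
  \sum_(A : {set T}) #|A|%:R * g #|A| =
  \sum_(A : {set T}) (n%:R - #|A|%:R) * g #|A|.+1.
Proof.
rewrite -(sum_mem_mul (fun A => g #|A|)).
under eq_bigr do rewrite -(sum_setU1 _ (fun A => g #|A|)).
transitivity (\sum_(b : T) \sum_(A : {set T} | b \notin A) g #|A|.+1).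
  by apply: eq_bigr => b _; apply: eq_bigr => A bA; rewrite cardsU1 bA.
rewrite (sum_notin_mul (fun A => g #|A|.+1)).
by apply: eq_bigr => A _; rewrite natrB ?max_card.
Qed.

Lemma sum_card_stein g :
  \sum_(A : {set T}) ((n%:R - #|A|%:R) * (g #|A|.+1 - g #|A|)
    - (2 * #|A|%:R - n%:R) * g #|A|) = 0.
Proof.
have H := sum_card_mul g.
rewrite (eq_bigr (fun A : {set T} => (n%:R - #|A|%:R) * g #|A|.+1
   - #|A|%:R * g #|A|)); last by move=> A _; ring.
by rewrite sumrB H subrr.
Qed.

Lemma sum_set1 : \sum_(A : {set T}) (1 : R) = 2 ^+ n.
Proof.
rewrite sumr_const; have <- : #|powerset [set: T]| = #|{: {set T}}|.
  by rewrite finset.powersetT cardsT.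
by rewrite card_powerset cardsT natrX.
Qed.

(** The mean comes from the Stein identity with constant g; the variance below comes from g(k) = k -
    n/2. *)
Lemma sum_card : \sum_(A : {set T}) #|A|%:R = n%:R / 2 * 2 ^+ n :> R.
Proof.
have := sum_card_stein (fun=> 1).
rewrite (eq_bigr (fun A : {set T} => n%:R * 1 - 2 * #|A|%:R)); last first.
  by move=> A _; ring.
rewrite sumrB -!mulr_sumr sum_set1; lra.
Qed.

Lemma sum_card_var :
  \sum_(A : {set T}) (#|A|%:R - n%:R / 2) ^+ 2 = n%:R / 4 * 2 ^+ n :> R.
Proof.
have := sum_card_stein (fun k => k%:R - n%:R / 2).
rewrite (eq_bigr (fun A : {set T} => n%:R * 1 - #|A|%:R
  - 2 * (#|A|%:R - n%:R / 2) ^+ 2)); last first.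
  by move=> A _; rewrite -natr1; field.
rewrite !sumrB -!mulr_sumr sum_set1 sum_card; lra.
Qed.

(** [kappa] is the ratio of the binomial variance n/4 to the square of the scale s. The bound
    involves k and [w k] only through k and [w k ^+ 2], whose averages over the cube are known
    exactly. *)
Lemma stein_error_pointwise s z (k : nat) :
  0 < s -> (k <= n)%N ->
  let w i : R := (i%:R - n%:R / 2) / s in let f := stein_sol z in
  let kappa := n%:R / (4 * s ^+ 2) in
  w k + s^-1 <= z \/ z <= w k ->
  `| 2 * s * kappa * ((w k < z)%R%:R - Phi z)
    - ((n%:R - k%:R) * (f (w k.+1) - f (w k)) - (2 * k%:R - n%:R) * f (w k)) | <=
  2 * s * `|1 - kappa| + (1 + w k ^+ 2)
    + (n%:R - k%:R) * (3 / 2 + 2 / s) / (2 * s ^+ 2)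
    + 2 * kappa * (1 + w k ^+ 2).
Proof.
move=> s0 kn w f kappa wz.
have sn0 : s != 0 by rewrite gt_eqF.
have wS : w k.+1 = w k + s^-1 by rewrite /w -natr1; field.
have k_w : k%:R = n%:R / 2 + s * w k by rewrite /w; field.
have sV0 : 0 <= s^-1 by rewrite invr_ge0 ltW.
have := stein_sol_step sV0 wz; rewrite -wS -/f.
set r := f _ - _ - _ => rle.
set c := (w k < z)%R%:R - Phi z.
have c1 : `|c| <= 1.
  have := @Phi_ge0 R z; have := @Phi_le1 R z => P1 P0.
  rewrite /c ler_norml; case: (w k < z) => /=; apply/andP; split; lra.
have wf1 := mul_stein_sol_le z (w k); rewrite -/f in wf1.
have nk0 : 0 <= n%:R - k%:R :> R by rewrite subr_ge0 ler_nat.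
(* Since n - k = 2 s^2 kappa - s w, three errors remain: the variance mismatch 1 - kappa, the drift
   of n - k away from n/2, and the Taylor remainder [r]. *)
have -> : 2 * s * kappa * c
    - ((n%:R - k%:R) * (f (w k.+1) - f (w k)) - (2 * k%:R - n%:R) * f (w k)) =
    2 * s * (1 - kappa) * (w k * f (w k)) + w k * (w k * f (w k) + c)
    - (n%:R - k%:R) * r.
  by rewrite /r /kappa /c k_w; field.
have w2 : `|w k| <= (1 + w k ^+ 2) / 2.
  have := sqr_ge0 (`|w k| - 1); rewrite sqrrB1 real_normK ?num_real//; lra.
have e1 : `|2 * s * (1 - kappa) * (w k * f (w k))| <= 2 * s * `|1 - kappa|.
  rewrite normrM 2!normrM ger0_norm// (gtr0_norm s0) ler_piMr// mulr_ge0//.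
  lra.
have e2 : `|w k * (w k * f (w k) + c)| <= 1 + w k ^+ 2.
  rewrite normrM; have -> : 1 + w k ^+ 2 = (1 + w k ^+ 2) / 2 * 2 by field.
  by rewrite ler_pM// (le_trans (ler_normD _ _))//; lra.
have e3 : `|(n%:R - k%:R) * r| <= (n%:R - k%:R) * (3 / 2 + 2 / s) / (2 * s ^+ 2)
    + 2 * kappa * (1 + w k ^+ 2).
  rewrite normrM (ger0_norm nk0).
  apply: (le_trans (ler_wpM2l nk0 rle)).
  have -> : (3 / 2 + 2 * (`|w k| + s^-1)) * s^-1 ^+ 2 / 2 =
     (3 / 2 + 2 / s) / (2 * s ^+ 2) + `|w k| / s ^+ 2 by field.
  rewrite mulrDr mulrA lerD2l.
  have -> : 2 * kappa * (1 + w k ^+ 2) = n%:R * ((1 + w k ^+ 2) / 2 / s ^+ 2).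
    by rewrite /kappa; field.
  apply: ler_pM => //.
  - by rewrite divr_ge0// sqr_ge0.
  - by rewrite gerBl.
  - by rewrite ler_wpM2r// invr_ge0 sqr_ge0.
apply: (le_trans (ler_normB _ _)); apply: (le_trans (lerD (ler_normD _ _) (lexx _))).
lra.
Qed.

(** At the lattice point [w k0] no step contains the kink, so the pointwise bound holds for every
    set. The Stein terms [G] sum to 0 and may be subtracted; averaging turns [w #|A| ^+ 2] into
    kappa and [#|A|] into n/2. *)
Lemma fair_coins_stein s kappa (k0 : nat) :
  0 < s -> kappa = n%:R / (4 * s ^+ 2) ->
  2 * s * kappa *
   `| (\sum_(A : {set T}) (#|A| < k0)%N%:R) / 2 ^+ n
      - Phi ((k0%:R - n%:R / 2) / s) | <=
  2 * s * `|1 - kappa| + (1 + kappa) + kappa * (3 / 2 + 2 / s)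
    + 2 * kappa * (1 + kappa).
Proof.
move=> s0 kappaE; pose w i : R := (i%:R - n%:R / 2) / s.
rewrite -[(k0%:R - _) / s]/(w k0).
have sn0 : s != 0 by rewrite gt_eqF.
have p0 : 0 < 2 ^+ n :> R by rewrite exprn_gt0.
have pn0 : 2 ^+ n != 0 :> R by rewrite gt_eqF.
have kappa0 : 0 <= kappa by rewrite kappaE divr_ge0// mulr_ge0// sqr_ge0.
have wlt k : (w k < w k0)%R = (k < k0)%N.
  by rewrite /w ltr_pM2r ?invr_gt0// ltrD2r ltr_nat.
have wz k : w k + s^-1 <= w k0 \/ w k0 <= w k.
  have -> : w k + s^-1 = w k.+1 by rewrite /w -natr1; field.
  rewrite /w !ler_pM2r ?invr_gt0// !lerD2r !ler_nat.
  by case: ltnP; [left|right].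
have H (A : {set T}) := stein_error_pointwise s0 (max_card (mem A)) (wz #|A|).
rewrite -kappaE in H.
rewrite -(ler_pM2r p0).
have sk0 : 0 <= 2 * s * kappa by rewrite mulr_ge0// mulr_ge0// ltW.
set D := (_ / _ - _ : R).
have -> : 2 * s * kappa * `|D| * 2 ^+ n = `|2 * s * kappa * (D * 2 ^+ n)|.
  by rewrite !normrM (gtr0_norm p0) (ger0_norm kappa0) (gtr0_norm s0) ger0_norm// mulrA.
pose F (A : {set T}) := 2 * s * kappa * ((w #|A| < w k0)%R%:R - Phi (w k0)).
have -> : 2 * s * kappa * (D * 2 ^+ n) = \sum_A F A.
  rewrite -mulr_sumr sumrB.
  under eq_bigr do rewrite wlt.
  have -> : \sum_(A : {set T}) Phi (w k0) = Phi (w k0) * 2 ^+ n :> R.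
    by rewrite -sum_set1 mulr_sumr; apply: eq_bigr => A _; rewrite mulr1.
  by rewrite /D; field.
pose G := fun A : {set T} => (n%:R - #|A|%:R)
  * (stein_sol (w k0) (w #|A|.+1) - stein_sol (w k0) (w #|A|))
  - (2 * #|A|%:R - n%:R) * stein_sol (w k0) (w #|A|).
have -> : \sum_A F A = \sum_A (F A - G A).
  by rewrite sumrB (sum_card_stein (stein_sol (w k0) \o w)) subr0.
apply: (le_trans (ler_norm_sum _ _ _)).
apply: (le_trans (ler_sum _ (fun A _ => H A))).
set c := (3 / 2 + 2 / s) / (2 * s ^+ 2).
rewrite (eq_bigr (fun A : {set T} =>
  (2 * s * `|1 - kappa| + 1 + 2 * kappa + n%:R * c) * 1 - c * #|A|%:R
  + (1 + 2 * kappa) * w #|A| ^+ 2)); last first.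
  by move=> A _; rewrite /c /w/=; field.
rewrite big_split sumrB/= -!mulr_sumr sum_set1 sum_card.
have -> : \sum_(A : {set T}) w #|A| ^+ 2 = kappa * 2 ^+ n.
  rewrite (eq_bigr (fun A : {set T} => (#|A|%:R - n%:R / 2) ^+ 2 / s ^+ 2)).
    by rewrite -mulr_suml sum_card_var kappaE; field.
  by move=> A _; rewrite /w expr_div_n.
have -> : n%:R = 4 * s ^+ 2 * kappa :> R by rewrite kappaE; field.
by rewrite le_eqVlt; apply/orP; left; apply/eqP; rewrite /c; field.
Qed.

Lemma fair_coins_normal s kappa z :
  0 < s -> 0 < kappa -> kappa = n%:R / (4 * s ^+ 2) ->
  `| (\sum_(A : {set T}) ((#|A|%:R - n%:R / 2) / s <= z)%R%:R) / 2 ^+ n - Phi z | <=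
  `|1 - kappa| / kappa
  + ((1 + kappa) / kappa + (3 / 2 + 2 / s) + 2 * (1 + kappa)) / (2 * s)
  + 1 / (2 * s).
Proof.
move=> s0 kappa0 kappaE.
have sn0 : s != 0 by rewrite gt_eqF.
have kn0 : kappa != 0 by rewrite gt_eqF.
pose w i : R := (i%:R - n%:R / 2) / s.
pose y := z * s + n%:R / 2.
have wy i : (w i <= z) = (i%:R <= y).
  by rewrite /w ler_pdivrMr// lerBlDr.
pose P k0 := (\sum_(A : {set T}) (#|A| < k0)%N%:R) / 2 ^+ n : R.
have main k0 : `|P k0 - Phi (w k0)| <= `|1 - kappa| / kappa
  + ((1 + kappa) / kappa + (3 / 2 + 2 / s) + 2 * (1 + kappa)) / (2 * s).
  rewrite -(ler_pM2l (mulr_gt0 (mulr_gt0 (ltr0n _ 2) s0) kappa0)).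
  apply: (le_trans (fair_coins_stein k0 s0 kappaE)).
  by rewrite le_eqVlt; apply/orP; left; apply/eqP; field; rewrite kn0 sn0.
(* For y < 0 the probability is 0, and Phi z <= Phi (w 0) is controlled by the lattice point k0 =
   0. *)
have [y0|y0] := ltP y 0.
  have -> : \sum_(A : {set T}) ((#|A|%:R - n%:R / 2) / s <= z)%R%:R = 0 :> R.
    apply: big1 => A _; rewrite -/(w #|A|) wy.
    by rewrite (lt_geF (lt_le_trans y0 _)).
  have zw : z <= w 0%N.
    by rewrite /w ler_pdivlMr//; move: y0; rewrite /y; lra.
  have P00 : P 0%N = 0 by rewrite /P big1 ?mul0r.
  rewrite mul0r; have := main 0%N; rewrite P00 !sub0r !normrN.
  rewrite !(ger0_norm (Phi_ge0 _)) => H.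
  have := Phi_mono zw.
  have : 0 <= 1 / (2 * s) by rewrite divr_ge0// mulr_ge0// ltW.
  lra.
(* Rounding z up to the next lattice point keeps the event and moves z by at most 1/s; [Phi] has
   Lipschitz constant 1/2, whence the term 1/(2s). *)
pose k0 := (Num.truncn y).+1.
have yk0 i : (i%:R <= y) = (i < k0)%N.
  by rewrite ltnS truncn_ge_nat.
have -> : (\sum_(A : {set T}) ((#|A|%:R - n%:R / 2) / s <= z)%R%:R) / 2 ^+ n = P k0.
  congr (_ / _); apply: eq_bigr => A _.
  by rewrite -/(w #|A|) wy yk0.
have zw : z <= w k0.
  rewrite /w ler_pdivlMr//; have := truncnS_gt y.
  by rewrite -/k0 /y; lra.
have wz : w k0 - z <= s^-1.
  have : (Num.truncn y)%:R <= y by rewrite truncn_le.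
  rewrite /w /k0 -natr1 /y => H.
  suff : ((Num.truncn y)%:R + 1 - n%:R / 2) / s <= z + s^-1 by lra.
  by rewrite ler_pdivrMr// mulrDl mulVf//; lra.
have := main k0; have /andP[l1 l2] := Phi_lipschitz zw.
have -> : 1 / (2 * s) = s^-1 / 2 by field.
rewrite !ler_norml => /andP[h1 h2]; apply/andP; split; lra.
Qed.

End fair_coins.

(** * Walsh analysis on the cube *)

Section fourier.
Context {R : realType} {T : finType}.
Local Notation n := #|T|.
Implicit Types (S A B : {set T}) (p f : {set T} -> R).

Definition chi S A : R := (-1) ^+ #|S :&: A|.

Lemma chiC S A : chi S A = chi A S.
Proof. by rewrite /chi finset.setIC. Qed.

Lemma chi_prod S A :
  chi S A = \prod_j (if j \in S then (-1) ^+ (j \in A) else 1).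
Proof.
rewrite /chi -prodr_const -big_mkcond /=.
under eq_bigl do rewrite finset.in_setI.
by rewrite big_mkcondr; apply: eq_bigr => j _; case: (j \in A).
Qed.

Lemma chi_norm S A : `|chi S A| = 1.
Proof. by rewrite normrX normrN1 expr1n. Qed.

(** The sum over S factors over coordinates into 1 + c_j, and a coordinate where A and B differ
    contributes the factor 0. *)
Lemma sum_chi_mul A B : \sum_S chi S A * chi S B = 2 ^+ n *+ (A == B).
Proof.
pose c j : R := (-1) ^+ (j \in A) * (-1) ^+ (j \in B).
transitivity (\prod_(j : T) (c j + 1)).
  rewrite bigA_distr; apply: eq_bigr => S _.
  rewrite !chi_prod -big_split; apply: eq_bigr => j _.
  by case: ifP => _ //=; rewrite mulr1.
have [AB|AB] := eqVneq A B.
  rewrite (eq_bigr (fun=> 2)) ?prodr_const// => j _.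
  by rewrite /c AB -expr2 sqrr_sign.
have [j jAB] : exists j, (j \in A) != (j \in B).
  apply/existsP; rewrite -negb_forall; apply: contra AB => /forallP AB.
  by apply/eqP/setP => j; apply/eqP/AB.
apply/eqP/prodf_eq0; exists j => //; rewrite /c.
by move: jAB; case: (j \in A); case: (j \in B) => //= _;
  rewrite !expr0 !expr1; apply/eqP; ring.
Qed.

Lemma sum_chi S : \sum_A chi S A = 2 ^+ n *+ (S == finset.set0).
Proof.
rewrite -sum_chi_mul; apply: eq_bigr => A _.
by rewrite chiC [chi A finset.set0]/chi finset.setI0 cards0 expr0 mulr1.
Qed.

Lemma parseval f :
  \sum_S (\sum_A f A * chi S A) ^+ 2 = 2 ^+ n * \sum_A f A ^+ 2.
Proof.
transitivity (\sum_S \sum_A \sum_B f A * f B * (chi S A * chi S B)).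
  apply: eq_bigr => S _; rewrite expr2 mulr_suml; apply: eq_bigr => A _.
  by rewrite mulr_sumr; apply: eq_bigr => B _; ring.
rewrite exchange_big mulr_sumr; apply: eq_bigr => A _ /=.
rewrite exchange_big /= (bigD1 A)//= [X in _ + X]big1 => [|B BA].
  by rewrite -mulr_sumr sum_chi_mul eqxx addr0 mulr1n; ring.
by rewrite -mulr_sumr sum_chi_mul eq_sym (negbTE BA) mulr0.
Qed.

(** Cauchy-Schwarz, in the form that the variance of |f| on the uniform cube is nonnegative. *)
Lemma sum_norm_le f : (\sum_A `|f A|) ^+ 2 <= 2 ^+ n * \sum_A f A ^+ 2.
Proof.
set L := \sum_A `|f A|.
have p0 : 0 < 2 ^+ n :> R by rewrite exprn_gt0.
have pn0 : 2 ^+ n != 0 :> R by rewrite gt_eqF.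
have : 0 <= \sum_A (`|f A| - L / 2 ^+ n) ^+ 2.
  by apply: sumr_ge0 => A _; exact: sqr_ge0.
rewrite (eq_bigr (fun A => f A ^+ 2 - 2 * (L / 2 ^+ n) * `|f A|
  + (L / 2 ^+ n) ^+ 2 * 1)); last first.
  by move=> A _; rewrite sqrrB real_normK ?num_real// -mulr_natl; ring.
rewrite big_split sumrB/= -!mulr_sumr sum_set1 -/L => H.
rewrite -(ler_pM2l p0) in H; rewrite -subr_ge0.
move: H; rewrite mulr0; congr (_ <= _).
by field.
Qed.

(** Subtracting the uniform density removes the Walsh coefficient at the empty set and leaves all
    others unchanged; then Cauchy-Schwarz and Parseval apply. *)
Lemma total_variation_le p :
  \sum_A p A = 1 ->
  (\sum_A `|p A - (2 ^+ n)^-1|) ^+ 2 <=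
  \sum_(S | S != finset.set0) (\sum_A p A * chi S A) ^+ 2.
Proof.
move=> p1; apply: (le_trans (sum_norm_le _)); rewrite -parseval.
have pn0 : 2 ^+ n != 0 :> R by rewrite gt_eqF// exprn_gt0.
have fE S : \sum_A (p A - (2 ^+ n)^-1) * chi S A =
    \sum_A p A * chi S A - (S == finset.set0)%:R.
  under eq_bigr do rewrite mulrBl.
  rewrite sumrB -mulr_sumr sum_chi; congr (_ - _).
  by case: eqP => _; rewrite ?mulr0// mulr1n mulVf.
have p0 : \sum_A p A * chi finset.set0 A = 1.
  rewrite -p1; apply: eq_bigr => A _.
  by rewrite /chi finset.set0I cards0 mulr1.
rewrite (bigD1 finset.set0)//= fE eqxx p0 subrr expr0n add0r ler_sum// => S S0.
by rewrite fE (negbTE S0) subr0.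
Qed.

Lemma sum_card_eq (g : nat -> R) :
  \sum_(A : {set T}) g #|A| = \sum_(k < n.+1) 'C(n, k)%:R * g k.
Proof.
rewrite (partition_big (fun A => inord #|A| : 'I_n.+1) xpredT)//=.
apply: eq_bigr => k _.
rewrite (eq_bigr (fun=> g k)); last first.
  by move=> A /eqP <-; rewrite inordK// ltnS max_card.
rewrite sumr_const mulr_natl; congr (_ *+ _).
rewrite -card_draws; apply: eq_card => A; rewrite finset.in_set unfold_in/=.
apply/eqP/eqP => [<-|Ak]; first by rewrite inordK// ltnS max_card.
by rewrite Ak inord_val.
Qed.

(** These are the Krawtchouk values: the generating polynomial of [chi S A] by the size of A factors
    over coordinates, with 1 - X on S and 1 + X off S. *)
Lemma sum_chi_card S k :
  \sum_(A : {set T} | #|A| == k) chi S A =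
    ((1 - 'X) ^+ #|S| * (1 + 'X) ^+ (n - #|S|))`_k.
Proof.
have -> : (1 - 'X) ^+ #|S| * (1 + 'X) ^+ (n - #|S|) =
    \sum_A (chi S A) *: 'X^#|A| :> {poly R}.
  transitivity (\prod_(j : T) (((-1) ^+ (j \in S)) *: 'X + 1) : {poly R}).
    rewrite (bigID (mem S))/=; congr (_ * _).
      rewrite (eq_bigr (fun=> 1 - 'X)) ?prodr_const// => j ->.
      by rewrite expr1 scaleN1r addrC.
    rewrite (eq_bigr (fun=> 1 + 'X)) ?prodr_const//; last first.
      by move=> j /negbTE ->; rewrite expr0 scale1r addrC.
    congr (_ ^+ _); rewrite -(cardsC S) addKn; apply: eq_card => j.
    by rewrite !inE.
  rewrite bigA_distr; apply: eq_bigr => A _.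
  by rewrite chiC chi_prod -!big_mkcond -prodr_const -scaler_prod.
rewrite coef_sum [RHS]big_mkcond/= big_mkcond; apply: eq_bigr => A _.
by rewrite coefZ coefXn eq_sym; case: ifP; rewrite ?mulr1 ?mulr0.
Qed.

End fourier.

(** * Walsh coefficients of the uniform law on the two middle layers *)

Section middle_layers.
Context {R : realType} {T : finType}.
Local Notation n := #|T|.
Implicit Types (S A B : {set T}).

Lemma sum_set_card (b : nat) (c : R) :
  \sum_(S : {set T} | #|S| == b) c = 'C(n, b)%:R * c.
Proof.
rewrite sumr_const mulr_natl -card_draws; congr (_ *+ _).
by apply: eq_card => A; rewrite finset.in_set.
Qed.

(* Double counting of the character values on pairs of a [b]-set and a [k]-set. *)
Lemma krawtchouk_reciprocity (b k : nat) :
  'C(n, b)%:R * ((1 - 'X) ^+ b * (1 + 'X) ^+ (n - b) : {poly R})`_k =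
  'C(n, k)%:R * ((1 - 'X) ^+ k * (1 + 'X) ^+ (n - k))`_b.
Proof.
have E (b' k' : nat) : 'C(n, b')%:R *
    ((1 - 'X) ^+ b' * (1 + 'X) ^+ (n - b') : {poly R})`_k' =
    \sum_(S : {set T} | #|S| == b') \sum_(A : {set T} | #|A| == k') chi S A.
  rewrite -sum_set_card; apply: eq_bigr => S /eqP <-.
  by rewrite sum_chi_card.
rewrite !E exchange_big/=; apply: eq_bigr => S _; apply: eq_bigr => A _.
exact: chiC.
Qed.

Lemma coef_one_subX (m j : nat) : `|((1 - 'X) ^+ m : {poly R})`_j| = 'C(m, j)%:R.
Proof.
rewrite exprBn coef_sum.
have E (i : 'I_m.+1) : (((-1) ^+ i * 1 ^+ (m - i) * 'X^i : {poly R}) *+ 'C(m, i))`_j =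
    if j == i then (-1) ^+ i * 'C(m, i)%:R else 0.
  rewrite expr1n mulr1 coefMn -signr_odd -!polyC1 -polyCN -rmorphXn/= coefCM coefXn.
  rewrite signr_odd mulr_natr; case: eqP => _ /=.
    by rewrite mulr1n mulr_natr.
  by rewrite mulr0n mul0rn.
rewrite (eq_bigr _ (fun i _ => E i)) -big_mkcond/=.
have [jm|jm] := leqP j m.
  rewrite (big_pred1 (inord j)) => [|i]; last first.
    by apply/eqP/eqP => ->; rewrite ?inord_val ?inordK.
  by rewrite inordK// normrM normrX normrN1 expr1n mul1r normr_nat.
rewrite bin_small// big1 ?normr0// => i /eqP ji; move: jm.
by rewrite ji ltnNge -ltnS ltn_ord.
Qed.

Lemma coef_one_subX2 (m b : nat) :
  `|((1 - 'X^2) ^+ m : {poly R})`_b| = if odd b then 0 else 'C(m, b./2)%:R.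
Proof.
have -> : (1 - 'X^2) ^+ m = ((1 - 'X) ^+ m) \Po 'X^2 :> {poly R}.
  by rewrite rmorphXn/= rmorphB/= rmorph1 comp_polyX.
rewrite coef_comp_poly_Xn// dvdn2 divn2; case: (odd b) => /=.
  by rewrite normr0.
exact: coef_one_subX.
Qed.

(** For n = 2m+1 both layers have C(n, m) sets, so this is the Walsh coefficient at S of the uniform
    law on their union. *)
Definition mid_chi (m : nat) S : R :=
  (\sum_(A : {set T} | #|A| == m) chi S A +
   \sum_(A : {set T} | #|A| == m.+1) chi S A) / (2 * 'C(n, m)%:R).

(** Reciprocity turns the size of S into the index of the coefficient. The two layer polynomials
    then have the common factor (1 - X^2)^m, with cofactors 1 + X and 1 - X adding up to 2. *)
Lemma mid_chiE (m : nat) S : n = (2 * m + 1)%N ->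
  'C(n, #|S|)%:R * mid_chi m S = ((1 - 'X^2) ^+ m)`_#|S|.
Proof.
move=> nE; set b := #|S|.
have C0 : 'C(n, m)%:R != 0 :> R by rewrite pnatr_eq0 -lt0n bin_gt0 nE; lia.
have CE : 'C(n, m.+1) = 'C(n, m).
  by rewrite -bin_sub ?nE; [congr 'C(_, _)|]; lia.
rewrite /mid_chi !sum_chi_card -/b mulrA mulrDr.
rewrite (krawtchouk_reciprocity b m) (krawtchouk_reciprocity b m.+1) CE.
rewrite -mulrDr -coefD.
have -> : (1 - 'X) ^+ m * (1 + 'X) ^+ (n - m)
    + (1 - 'X) ^+ m.+1 * (1 + 'X) ^+ (n - m.+1) = 2%:P * (1 - 'X^2) ^+ m :> {poly R}.
  have -> : (n - m = m.+1)%N by lia.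
  have -> : (n - m.+1 = m)%N by lia.
  have -> : 1 - 'X^2 = (1 - 'X) * (1 + 'X) :> {poly R} by ring.
  by rewrite exprMn !exprS -[2%:P]/(2%:R%:P) rmorph_nat; ring.
by rewrite coefCM; field.
Qed.

Lemma bin_ge_self (k j : nat) : (0 < j < k)%N -> (k <= 'C(k, j))%N.
Proof.
elim: k j => [|k IH] [|j] // /andP[_ jk]; rewrite binS.
have [jk'|jk'] := ltnP j.+1 k.
  have := IH j.+1 jk'; have : (0 < 'C(k, j))%N by rewrite bin_gt0; lia.
  lia.
have -> : k = j.+1 by lia.
by rewrite binn binSn; lia.
Qed.

(** The left side is a single term of Vandermonde's convolution for 2m + 1 = m + (m + 1). *)
Lemma bin_mul_le (m j : nat) : (j <= m)%N ->
  ('C(m, j) * 'C(m.+1, j) <= 'C(2 * m + 1, 2 * j))%N.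
Proof.
move=> jm; have -> : (2 * m + 1 = m + m.+1)%N by lia.
rewrite -binomial.Vandermonde.
have jlt : (j < (2 * j).+1)%N by lia.
rewrite (bigD1 (Ordinal jlt))//=.
have -> : (2 * j - j = j)%N by lia.
by rewrite leq_addr.
Qed.

(** For |S| = 2j, x = [mid_chi m S] satisfies |x| C(m+1, j) <= 1. Hence |x| <= 1/(m+1), and C(n, 2j)
    x^2 = C(m, j) |x| <= 1; the product of the last bound with x^2 <= 1/(m+1)^2 is the claim. *)
Lemma mid_chi_pow4 (m : nat) S : n = (2 * m + 1)%N -> S != finset.set0 ->
  'C(n, #|S|)%:R * mid_chi m S ^+ 4 <= (m.+1%:R ^+ 2)^-1.
Proof.
move=> nE S0; have := mid_chiE S nE; set b := #|S|; set x := mid_chi m S => xE.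
have b0 : (0 < b)%N by rewrite card_gt0.
have bn : (b <= n)%N by exact: max_card.
have C0 : 0 < 'C(n, b)%:R :> R by rewrite ltr0n bin_gt0.
have := coef_one_subX2 m b; rewrite -xE normrM (gtr0_norm C0).
case: ifPn => [_ /eqP|ob xC].
  rewrite mulf_eq0 gt_eqF//= normr_eq0 => /eqP ->.
  by rewrite expr0n/= mulr0 invr_ge0 sqr_ge0.
have bE : b = (2 * b./2)%N by rewrite mul2n even_halfK.
set j := b./2 in xC bE.
have jm : (0 < j <= m)%N by lia.
have /andP[j0 jm1] := jm.
have Cj0 : 0 < 'C(m, j)%:R :> R by rewrite ltr0n bin_gt0.
have h1 : 'C(m, j)%:R * 'C(m.+1, j)%:R <= 'C(n, b)%:R :> R.
  by rewrite -natrM ler_nat nE bE bin_mul_le.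
have h2 : m.+1%:R <= 'C(m.+1, j)%:R :> R by rewrite ler_nat bin_ge_self//; lia.
have h3 : 'C(m, j)%:R <= 'C(m.+1, j)%:R :> R.
  by rewrite ler_nat; case: (j) j0 => // i _; rewrite binS leq_addr.
have m0 : 0 < m.+1%:R :> R by [].
have D0 : 0 < 'C(m.+1, j)%:R :> R := lt_le_trans m0 h2.
have x0 : 0 <= `|x| by [].
have xD : `|x| * 'C(m.+1, j)%:R <= 1.
  rewrite -(ler_pM2l C0) mulr1 mulrA xC; exact: h1.
have x1 : `|x| <= m.+1%:R^-1.
  rewrite -[leRHS]mul1r ler_pdivlMr//.
  exact: le_trans (ler_wpM2l x0 h2) xD.
have Cx2 : 'C(n, b)%:R * `|x| ^+ 2 <= 1.
  rewrite expr2 mulrA xC mulrC.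
  exact: le_trans (ler_wpM2l x0 h3) xD.
have -> : x ^+ 4 = `|x| ^+ 2 * `|x| ^+ 2.
  by rewrite real_normK ?num_real//; ring.
rewrite mulrA -exprVn -[leRHS]mul1r.
by apply: ler_pM => //; rewrite ?mulr_ge0 ?exprn_ge0 ?lerXn2r ?nnegrE ?invr_ge0.
Qed.

Lemma sum_mid_chi_pow4 (m : nat) : n = (2 * m + 1)%N ->
  \sum_(S : {set T} | S != finset.set0) mid_chi m S ^+ 4 <= 2 / m.+1%:R.
Proof.
move=> nE.
have m0 : 0 < m.+1%:R :> R by [].
pose c := (m.+1%:R ^+ 2)^-1 : R.
(* Each of the n nonempty layers contributes at most c, and n <= 2(m+1); the value 0 at k = 0 omits
   the empty set. *)
pose g (k : nat) : R := if k == 0%N then 0 else c / 'C(n, k)%:R.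
apply: (@le_trans _ _ (\sum_(S : {set T}) g #|S|)).
  rewrite [leRHS](bigD1 finset.set0)//= /g cards0 eqxx add0r ler_sum// => S S0.
  rewrite cards_eq0 (negbTE S0) ler_pdivlMr ?ltr0n ?bin_gt0 ?max_card//.
  by rewrite mulrC mid_chi_pow4.
rewrite sum_card_eq big_ord_recl /g/= mulr0 add0r.
rewrite (eq_bigr (fun=> c)) => [|i _]; last first.
  by rewrite /bump/= mulrC divfK// pnatr_eq0 -lt0n bin_gt0 /bump/= add1n.
rewrite sumr_const card_ord -[leLHS]mulr_natl nE /c.
rewrite ler_pdivrMr ?exprn_gt0//.
have -> : 2 / m.+1%:R * m.+1%:R ^+ 2 = 2 * m.+1%:R :> R by field; rewrite gt_eqF.
by rewrite -natrM ler_nat; lia.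
Qed.

End middle_layers.

(** * The modified lightbulb process *)

Section modified_stage.
Context {R : realType} {T : finType}.
Local Notation n := #|T|.
Implicit Types (S A B : {set T}) (h : {set T} -> R).

(** Not a flip: the switch of b is set to the value c, as the coins do in the modified stages. *)
Definition toggle (c : bool) (b : T) A : {set T} := if c then b |: A else A :\ b.

Lemma in_toggle c b A j : (j \in toggle c b A) = if j == b then c else j \in A.
Proof. by case: c; rewrite /toggle !inE; case: eqP. Qed.

Lemma sum_bool (f : bool -> R) : \sum_c f c = f true + f false.
Proof. by rewrite big_bool. Qed.

Lemma sum_card_indicator (k : nat) (c : R) h :
  \sum_(A : {set T}) c * ((#|A| == k)%:R * h A) =
  c * \sum_(A : {set T} | #|A| == k) h A.
Proof.
rewrite -mulr_sumr; congr (_ * _); rewrite [RHS]big_mkcond/=.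
by apply: eq_bigr => A _; case: eqP => _; rewrite ?mul1r ?mul0r.
Qed.

Context (m : nat) (S : {set T}) (nE : n = (2 * m + 1)%N).

Let C0 : 'C(n, m)%:R != 0 :> R.
Proof. by rewrite pnatr_eq0 -lt0n bin_gt0 nE; lia. Qed.

Let CE : 'C(n, m.+1) = 'C(n, m).
Proof. by rewrite -bin_sub ?nE; [congr 'C(_, _)|]; lia. Qed.

Let K : R := ('C(n, m)%:R * m.+1%:R * 2)^-1.

(** An (m+1)-set contains m+1 choices of b and an m-set misses n - m = m+1 of them, so every set of
    both layers receives the same mass. *)
Let mid_chi_toggle :
  \sum_(b : T)
    (K * \sum_(A : {set T} | b \in A) ((#|A| == m.+1)%:R * chi S A)
     + K * \sum_(A : {set T} | b \notin A) ((#|A| == m)%:R * chi S A)) =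
  mid_chi m S.
Proof.
rewrite big_split/= -!mulr_sumr.
rewrite sum_mem_mul sum_notin_mul /mid_chi.
rewrite (eq_bigr (fun A : {set T} => m.+1%:R * ((#|A| == m.+1)%:R * chi S A))); last first.
  by move=> A _; case: eqP => [->|]; rewrite ?mul0r ?mulr0.
rewrite [X in _ + K * X](eq_bigr (fun A : {set T} => m.+1%:R * ((#|A| == m)%:R * chi S A)));
    last first.
  move=> A _; case: eqP => [->|]; rewrite ?mul0r ?mulr0//.
  by congr (_%:R * _); lia.
rewrite !sum_card_indicator /K; field.
by rewrite C0/= gt_eqF.
Qed.

(** The coin either keeps the uniform m-set or adds a uniform missing bulb, which produces a uniform
    (m+1)-set. In the upper stage, the coin symmetrically keeps or removes a bulb. *)
Lemma lower_stage_chi :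
  \sum_(b : T) \sum_(c : bool) \sum_(A : {set T})
     (#|A| == m)%:R / 'C(n, m)%:R * ((b \notin A)%:R / m.+1%:R * 2^-1)
     * chi S (toggle c b A) = mid_chi m S :> R.
Proof.
have E (b : T) : \sum_(c : bool) \sum_(A : {set T})
     (#|A| == m)%:R / 'C(n, m)%:R * ((b \notin A)%:R / m.+1%:R * 2^-1)
     * chi S (toggle c b A) =
   K * \sum_(A : {set T} | b \in A) ((#|A| == m.+1)%:R * chi S A)
   + K * \sum_(A : {set T} | b \notin A) ((#|A| == m)%:R * chi S A) :> R.
  rewrite sum_bool -sum_setU1 !mulr_sumr !(big_mkcond (fun A => b \notin A))/=.
  congr (_ + _); apply: eq_bigr => A _; case: ifPn => bA /=; rewrite ?mul0r ?mulr0 ?mul0r//.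
    by rewrite cardsU1 bA eqSS /K; field; rewrite C0/= gt_eqF.
  have -> : A :\ b = A.
    by apply/setP => j; rewrite !inE; case: eqP => // ->; rewrite (negbTE bA).
  by rewrite /K; field; rewrite C0/= gt_eqF.
by rewrite (eq_bigr _ (fun b _ => E b)) mid_chi_toggle.
Qed.

Lemma upper_stage_chi :
  \sum_(b : T) \sum_(c : bool) \sum_(A : {set T})
     (#|A| == m.+1)%:R / 'C(n, m.+1)%:R * ((b \in A)%:R / m.+1%:R * 2^-1)
     * chi S (toggle c b A) = mid_chi m S :> R.
Proof.
have E (b : T) : \sum_(c : bool) \sum_(A : {set T})
     (#|A| == m.+1)%:R / 'C(n, m.+1)%:R * ((b \in A)%:R / m.+1%:R * 2^-1)
     * chi S (toggle c b A) =
   K * \sum_(A : {set T} | b \in A) ((#|A| == m.+1)%:R * chi S A)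
   + K * \sum_(A : {set T} | b \notin A) ((#|A| == m)%:R * chi S A) :> R.
  rewrite sum_bool -(sum_setD1 b) !mulr_sumr !(big_mkcond (fun A => b \in A))/= CE.
  congr (_ + _); apply: eq_bigr => A _; case: ifPn => bA /=; rewrite ?mul0r ?mulr0 ?mul0r//.
    have -> : b |: A = A.
      by apply/setP => j; rewrite !inE; case: eqP => // ->; rewrite bA.
    by rewrite /K; field; rewrite C0/= gt_eqF.
  rewrite (cardsD1 b A) bA add1n eqSS /K; field; by rewrite C0/= gt_eqF.
by rewrite (eq_bigr _ (fun b _ => E b)) mid_chi_toggle.
Qed.

Lemma plain_stage_chi (r : nat) : (r <= n)%N ->
  `|\sum_(A : {set T}) (#|A| == r)%:R / 'C(n, r)%:R * chi S A : R| <= 1.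
Proof.
move=> rn; apply: (le_trans (ler_norm_sum _ _ _)).
have Cr : 'C(n, r)%:R != 0 :> R by rewrite pnatr_eq0 -lt0n bin_gt0.
rewrite (eq_bigr (fun A : {set T} => 'C(n, r)%:R^-1 * ((#|A| == r)%:R * 1))).
  by rewrite sum_card_indicator sum_set_card mulr1 mulVf.
move=> A _; rewrite !normrM chi_norm mulr1 normfV !normr_nat mulr1.
exact: mulrC.
Qed.

End modified_stage.

(** * Walsh coefficients of the final bulb vector and its distance to the uniform law *)

Section lightbulb.
Context {R : realType}.
Context (m : nat).
Local Notation n := (2 * m + 1)%N.
Local Notation T := 'I_n.
Implicit Types (w : omega m) (S : {set T}).

Let cardT : #|{: T}| = n.
Proof. exact: card_ord. Qed.

Let m_stage : (m < n.+1)%N. Proof. lia. Qed.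
Let mS_stage : (m.+1 < n.+1)%N. Proof. lia. Qed.

Definition lit w : {set T} := [set j | odd (\sum_(r : 'I_n.+1) Vrj w r j)].

Lemma card_lit w : #|lit w| = Vtot w.
Proof.
rewrite -sum1_card big_mkcond /Vtot /Vj; apply: eq_bigr => j _.
by rewrite modn2 inE; case: (odd _).
Qed.

Definition toggled w (r : 'I_n.+1) : {set T} := [set j | Vrj w r j].

(** Characters turn addition modulo 2 of the stages into multiplication. *)
Lemma chi_lit S w : chi S (lit w) = \prod_(r : 'I_n.+1) chi S (toggled w r) :> R.
Proof.
rewrite chi_prod; under [RHS]eq_bigr do rewrite chi_prod.
rewrite exchange_big/=; apply: eq_bigr => j _.
case: ifP => _; last by rewrite big1.
rewrite finset.in_set signr_odd -prodrXr.
by apply: eq_bigr => r _; rewrite finset.in_set.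
Qed.

(** The sum over X is innermost because, for fixed auxiliary bulbs and coins, weight times character
    is a product over stages. *)
Lemma sum_omega (F : omega m -> R) :
  \sum_w F w = \sum_(bm : T) \sum_(cm : bool) \sum_(bm1 : T) \sum_(cm1 : bool)
    \sum_(X : {ffun 'I_n.+1 -> {set T}}) F (X, bm, bm1, cm, cm1).
Proof.
have pair (I J : finType) (G : I * J -> R) : \sum_p G p = \sum_i \sum_j G (i, j).
  by rewrite pair_bigA; apply: eq_bigr => -[].
rewrite !pair exchange_big/=; apply: eq_bigr => bm _.
under eq_bigr do rewrite exchange_big/=.
rewrite exchange_big/=; apply: eq_bigr => cm _.
rewrite exchange_big/=; apply: eq_bigr => bm1 _.
exact: exchange_big.
Qed.

(** Stages m and m+1 absorb the weights of their own auxiliary bulb and coin, the constant 1/4 being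
    split as 1/2 times 1/2. *)
Definition stage_factor (bm : T) (cm : bool) (bm1 : T) (cm1 : bool) S (r : 'I_n.+1)
    (A : {set T}) : R :=
  (#|A| == r)%:R / 'C(n, r)%:R *
  (if val r == m then (bm \notin A)%:R / m.+1%:R * 2^-1 * chi S (toggle cm bm A)
   else if val r == m.+1 then (bm1 \in A)%:R / m.+1%:R * 2^-1 * chi S (toggle cm1 bm1 A)
   else chi S A).

Lemma weight_chi S (X : {ffun 'I_n.+1 -> {set T}}) bm bm1 cm cm1 :
  let w := (X, bm, bm1, cm, cm1) : omega m in
  weight w * chi S (lit w) = \prod_r stage_factor bm cm bm1 cm1 S r (X r).
Proof.
move=> w; rewrite chi_lit /stage_factor big_split/= /w /weight.
have -> : (n - m = m.+1)%N by lia.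
rewrite -!mulrA; congr (_ * _).
rewrite (bigD1 (Ordinal m_stage))//= [in RHS](bigD1 (Ordinal m_stage))//= eqxx.
rewrite (bigD1 (Ordinal mS_stage))/=; last by rewrite -val_eqE/= gtn_eqF.
rewrite [in RHS](bigD1 (Ordinal mS_stage))/=; last by rewrite -val_eqE/= gtn_eqF.
have -> : (m.+1 == m) = false by rewrite gtn_eqF.
rewrite eqxx.
have mE : inord m = Ordinal m_stage by apply: val_inj; rewrite /= inordK.
have mSE : inord m.+1 = Ordinal mS_stage by apply: val_inj; rewrite /= inordK.
rewrite mE mSE.
have tm : toggled w (Ordinal m_stage) = toggle cm bm (X (Ordinal m_stage)).
  by apply/setP => j; rewrite finset.in_set in_toggle/= eqxx/= ltn_eqF.
have tm1 : toggled w (Ordinal mS_stage) = toggle cm1 bm1 (X (Ordinal mS_stage)).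
  by apply/setP => j; rewrite finset.in_set in_toggle/= gtn_eqF// eqxx.
rewrite tm tm1.
have -> : \prod_(r | (r != Ordinal m_stage) && (r != Ordinal mS_stage)) chi S (toggled w r)
  = \prod_(r | (r != Ordinal m_stage) && (r != Ordinal mS_stage))
     (if val r == m then (bm \notin X r)%:R / m.+1%:R * 2^-1 * chi S (toggle cm bm (X r))
   else if val r == m.+1 then (bm1 \in X r)%:R / m.+1%:R * 2^-1 * chi S (toggle cm1 bm1 (X r))
   else chi S (X r)) :> R.
  apply: eq_bigr => r /andP[rm rm1].
  move: (rm) (rm1); rewrite -!val_eqE/= => /negbTE rm' /negbTE rm1'.
  rewrite rm' rm1'; congr (chi S _).
  by apply/setP => j; rewrite finset.in_set /= rm' rm1'.
by field; rewrite gt_eqF.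
Qed.

Definition other_stages (r : 'I_n.+1) := (r != Ordinal m_stage) && (r != Ordinal mS_stage).

Definition stage_chi S (r : nat) : R :=
  \sum_(A : {set T}) (#|A| == r)%:R / 'C(#|{: T}|, r)%:R * chi S A.

Lemma expect_chiE S : \sum_(w : omega m) weight w * chi S (lit w) =
  mid_chi m S ^+ 2 * \prod_(r | other_stages r) stage_chi S r :> R.
Proof.
pose Lm bm cm : R := \sum_(A : {set T})
     (#|A| == m)%:R / 'C(#|{: T}|, m)%:R * ((bm \notin A)%:R / m.+1%:R * 2^-1)
     * chi S (toggle cm bm A).
pose LmS bm cm : R := \sum_(A : {set T})
     (#|A| == m.+1)%:R / 'C(#|{: T}|, m.+1)%:R * ((bm \in A)%:R / m.+1%:R * 2^-1)
     * chi S (toggle cm bm A).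
pose P : R := \prod_(r | other_stages r) stage_chi S r.
have E bm cm bm1 cm1 : \sum_(X : {ffun 'I_n.+1 -> {set T}})
    weight (X, bm, bm1, cm, cm1) * chi S (lit (X, bm, bm1, cm, cm1)) =
    Lm bm cm * (LmS bm1 cm1 * P).
  under eq_bigr do rewrite weight_chi.
  rewrite -bigA_distr_bigA/= (bigD1 (Ordinal m_stage))//=.
  rewrite (bigD1 (Ordinal mS_stage))/=; last by rewrite -val_eqE/= gtn_eqF.
  congr (_ * (_ * _)).
  - by apply: eq_bigr => A _; rewrite /stage_factor/= eqxx cardT !mulrA.
  - by apply: eq_bigr => A _; rewrite /stage_factor/= (gtn_eqF (ltnSn m)) eqxx cardT !mulrA.
  - apply: eq_bigr => r /andP[rm rm1]; apply: eq_bigr => A _.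
    move: rm rm1; rewrite -!val_eqE/= => /negbTE rm /negbTE rm1.
    by rewrite /stage_factor rm rm1 cardT.
rewrite sum_omega.
rewrite expr2 -{1}(lower_stage_chi S cardT) -(upper_stage_chi S cardT).
rewrite -mulrA mulr_suml; apply: eq_bigr => bm _.
rewrite mulr_suml; apply: eq_bigr => cm _.
rewrite [X in _ = _ * X]mulr_suml mulr_sumr.
apply: eq_bigr => bm1 _.
rewrite [X in _ = _ * X]mulr_suml mulr_sumr; apply: eq_bigr => cm1 _.
exact: E.
Qed.

Lemma expect_chi_le S :
  `|\sum_(w : omega m) weight w * chi S (lit w) : R| <= mid_chi m S ^+ 2.
Proof.
rewrite expect_chiE normrM (ger0_norm (sqr_ge0 _)) ler_piMr ?sqr_ge0//.
rewrite normr_prod prodr_ile1// => r _; rewrite normr_ge0/=.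
by apply: plain_stage_chi; rewrite cardT -ltnS ltn_ord.
Qed.

(** The total mass is the Walsh coefficient at the empty set, so [expect_chiE] computes it. *)
Lemma sum_weight : \sum_(w : omega m) weight w = 1 :> R.
Proof.
have chi0 A : chi finset.set0 A = 1 :> R.
  by rewrite /chi finset.set0I cards0.
have sum0 r : \sum_(A : {set T} | #|A| == r) chi finset.set0 A = 'C(n, r)%:R :> R.
  by under eq_bigr do rewrite chi0; rewrite sum_set_card cardT mulr1.
have -> : \sum_(w : omega m) weight w =
    \sum_(w : omega m) weight w * chi finset.set0 (lit w) :> R.
  by apply: eq_bigr => w _; rewrite chi0 mulr1.
rewrite expect_chiE big1 => [|r _].
  have C0 : 'C(n, m)%:R != 0 :> R by rewrite pnatr_eq0 -lt0n bin_gt0; lia.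
  rewrite /mid_chi !sum0 cardT; have -> : 'C(n, m.+1) = 'C(n, m).
    by rewrite -bin_sub; [congr 'C(_, _)|]; lia.
  by field.
have C0 : 'C(n, r)%:R != 0 :> R by rewrite pnatr_eq0 -lt0n bin_gt0 -ltnS ltn_ord.
rewrite /stage_chi cardT (eq_bigr (fun A : {set T} =>
  'C(n, r)%:R^-1 * ((#|A| == r)%:R * chi finset.set0 A))).
  by rewrite sum_card_indicator sum0 mulVf.
by move=> A _; rewrite mulrCA mulrA.
Qed.

(** The L1 distance between the law [p] of [lit] and the uniform law bounds the error for every
    event; its square is at most the sum of [mid_chi m S ^+ 4] over nonempty S. *)
Lemma lightbulb_total_variation (D : pred nat) :
  `|Prob (fun w : omega m => D (Vtot w))
    - (\sum_(A : {set T}) (D #|A|)%:R) / 2 ^+ n| <= Num.sqrt (2 / m.+1%:R) :> R.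
Proof.
pose p (A : {set T}) : R := \sum_(w | lit w == A) weight w.
have pE (g : {set T} -> R) : \sum_A p A * g A = \sum_w weight w * g (lit w).
  rewrite [RHS](partition_big lit xpredT)//=; apply: eq_bigr => A _.
  by rewrite mulr_suml; apply: eq_bigr => w /eqP ->.
have p1 : \sum_A p A = 1.
  rewrite -sum_weight -[RHS](eq_bigr _ (fun w _ => mulr1 _)) -(pE (fun=> 1)).
  by apply: eq_bigr => A _; rewrite mulr1.
have tv := total_variation_le p1.
rewrite cardT in tv.
have : Prob (fun w : omega m => D (Vtot w)) = \sum_A p A * (D #|A|)%:R.
  rewrite pE /Prob big_mkcond; apply: eq_bigr => w _.
  by rewrite card_lit; case: (D _); rewrite ?mulr1 ?mulr0.
move=> ->; rewrite mulr_suml -sumrB.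
have -> : \sum_A (p A * (D #|A|)%:R - (D #|A|)%:R / 2 ^+ n) =
    \sum_A (p A - (2 ^+ n)^-1) * (D #|A|)%:R.
  by apply: eq_bigr => A _; ring.
apply: (@le_trans _ _ (\sum_A `|p A - (2 ^+ n)^-1|)).
  apply: (le_trans (ler_norm_sum _ _ _)); apply: ler_sum => A _.
  by rewrite normrM normr_nat ler_piMr//; case: (D _).
have s0 : 0 <= \sum_A `|p A - (2 ^+ n)^-1| by apply: sumr_ge0.
rewrite -[leLHS](ger0_norm s0) -sqrtr_sqr ler_wsqrtr// (le_trans tv)//.
apply: le_trans (sum_mid_chi_pow4 cardT); apply: ler_sum => S _.
have -> : mid_chi m S ^+ 4 = (mid_chi m S ^+ 2) ^+ 2 :> R by ring.
rewrite -real_normK ?num_real// lerXn2r ?nnegrE ?sqr_ge0// pE.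
exact: expect_chi_le.
Qed.

End lightbulb.

(** * The size of the variance parameter *)

Section variance.
Context {R : realType}.

(** Written in n - 2s, the value is immediate at the middle stages: there (n - 2s)^2 = 1 and the
    quotient is -1/n. *)
Lemma lam2E (n s : nat) : (1 < n)%N ->
  lam n 2 s = ((n%:R - 2 * s%:R) ^+ 2 - n%:R) / (n%:R * (n%:R - 1)) :> R.
Proof.
case: n => [|[|n]]// _.
have h k : (k ^_ 2)%:R = k%:R * (k%:R - 1) :> R.
  case: k => [|k]; first by rewrite mul0r.
  by rewrite ffactnS ffactn1 /= -[in k.+1%:R - 1]natr1 natrM addrK.
rewrite /lam !big_ord_recr big_ord0/= !ffactn0 !ffactn1 !h /=.
have -> : 'C(2, 0) = 1%N by [].
have -> : 'C(2, 1) = 2%N by [].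
have -> : 'C(2, 2) = 1%N by [].
have n0 : n.+2%:R != 0 :> R by [].
have n1 : n.+2%:R - 1 != 0 :> R by rewrite -natr1 addrK.
move: n.+2%:R n0 n1 => x x0 x1.
by field; apply/andP.
Qed.

Lemma lam2_le1 (n s : nat) : (1 < n)%N -> (s <= n)%N -> `|lam n 2 s : R| <= 1.
Proof.
move=> n1 sn; rewrite lam2E//.
have n2 : 2 <= n%:R :> R by rewrite ler_nat.
have s0 : 0 <= s%:R :> R by [].
have sn' : s%:R <= n%:R :> R by rewrite ler_nat.
have D0 : 0 < n%:R * (n%:R - 1) :> R by apply: mulr_gt0; lra.
rewrite normrM normfV (gtr0_norm D0) ler_pdivrMr// mul1r ler_norml.
have h1 : 0 <= s%:R * (n%:R - s%:R) :> R by rewrite mulr_ge0// subr_ge0.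
have h2 : 0 <= n%:R * (n%:R - 2) :> R by rewrite mulr_ge0// subr_ge0.
have h3 := sqr_ge0 (n%:R - 2 * s%:R : R).
by apply/andP; split; lra.
Qed.

Lemma lambar_le (m : nat) : (0 < m)%N ->
  `|lambar m : R| <= (2 * m + 1)%:R ^- 2.
Proof.
move=> m0; rewrite /lambar; set n := (2 * m + 1)%N.
have n1 : (1 < n)%N by rewrite /n; lia.
have n2 : 2 <= n%:R :> R by rewrite ler_nat.
have nE : n%:R = 2 * m%:R + 1 :> R by rewrite natrD natrM.
have l0 : lam n 2 m = - n%:R^-1 :> R.
  by rewrite lam2E// nE in n2 *; field; apply/andP; split; lra.
have l1 : lam n 2 m.+1 = - n%:R^-1 :> R.
  by rewrite lam2E// -natr1 nE in n2 *; field; apply/andP; split; lra.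
have -> : ((lam n 2 m + lam n 2 m.+1) / 2) ^+ 2 = n%:R ^- 2 :> R.
  by rewrite l0 l1; field; lra.
rewrite normrM [`|_ ^- 2|]ger0_norm ?invr_ge0 ?sqr_ge0//.
rewrite ler_piMl ?invr_ge0 ?sqr_ge0// normr_prod big_nat_cond.
apply: prodr_ile1 => s /andP[/andP[_ sn] _]; rewrite normr_ge0/=.
by apply: lam2_le1 => //; rewrite -ltnS.
Qed.

Lemma sigmaV2_bounds (m : nat) : (0 < m)%N ->
  ((2 * m + 1)%:R - 1) / 4 <= (sigmaV2 m : R) <= ((2 * m + 1)%:R + 1) / 4.
Proof.
move=> m0; set n : R := (2 * m + 1)%:R.
have := lambar_le m0; rewrite ler_norml -/n => /andP[l1 l2].
have n2 : 2 <= n by rewrite ler_nat; lia.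
have sE : sigmaV2 m = n / 4 + n * (n - 1) / 4 * lambar m.
  by rewrite /sigmaV2 -/n; field.
have h : n * (n - 1) / 4 * n ^- 2 <= 1 / 4.
  rewrite mulrAC ler_pdivrMr//; have -> : n * (n - 1) * n ^- 2 = 1 - n^-1.
    by field; lra.
  have : 0 <= n^-1 by rewrite invr_ge0; lra.
  lra.
have k0 : 0 <= n * (n - 1) / 4 by apply: divr_ge0 => //; apply: mulr_ge0; lra.
have := ler_wpM2l k0 l1; have := ler_wpM2l k0 l2; rewrite sE mulrN => h1 h2.
by apply/andP; split; lra.
Qed.

End variance.

(** * Numerical comparison of the constants and conclusion *)

Lemma numeric_bound {R : realType} (m : nat) (n s kappa : R) : (3 <= m)%N -> 0 < s ->
  n = (2 * m + 1)%:R -> kappa = n / (4 * s ^+ 2) ->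
  (n - 1) / 4 <= s ^+ 2 <= (n + 1) / 4 ->
  Num.sqrt (2 / m.+1%:R) + (`|1 - kappa| / kappa
  + ((1 + kappa) / kappa + (3 / 2 + 2 / s) + 2 * (1 + kappa)) / (2 * s)
  + 1 / (2 * s)) <= 164 / 100 * n / s ^+ 3 + 2 / s.
Proof.
move=> m3 s0 nE kappaE /andP[s_ge s_le].
have n7 : 7 <= n by rewrite nE ler_nat; lia.
have mE : m.+1%:R = (n + 1) / 2 :> R by rewrite nE natrD natrM -natr1; field.
have sn0 : s != 0 by rewrite gt_eqF.
have nn0 : n != 0 by rewrite gt_eqF//; lra.
pose u := s^-1.
have u0 : 0 < u by rewrite invr_gt0.
have us : u * s = 1 by rewrite mulVf.
have s2 : 0 < s ^+ 2 by rewrite exprn_gt0.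
have k0 : 0 < kappa by rewrite kappaE divr_gt0//; lra.
have tv : Num.sqrt (2 / m.+1%:R) <= u.
  rewrite -(ger0_norm (ltW u0)) -sqrtr_sqr ler_wsqrtr// mE /u exprVn.
  rewrite -[leRHS]mul1r ler_pdivlMr// mulrAC ler_pdivrMr ?mul1r; last by lra.
  lra.
have s4 : 4 * s <= n.
  rewrite -(@ler_pXn2r _ 2)// ?nnegrE; [|lra|lra].
  rewrite exprMn; have : 7 * n <= n ^+ 2 by rewrite expr2 ler_wpM2r//; lra.
  lra.
have e1 : `|1 - kappa| / kappa <= u / 4.
  have -> : `|1 - kappa| / kappa = `|4 * s ^+ 2 - n| / n.
    have -> : 1 - kappa = (4 * s ^+ 2 - n) / (4 * s ^+ 2) by rewrite kappaE; field.
    rewrite normrM normfV (@gtr0_norm _ (4 * _)) ?mulr_gt0// kappaE; field.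
    by rewrite sn0 nn0.
  have : `|4 * s ^+ 2 - n| <= 1 by rewrite ler_norml; apply/andP; split; lra.
  move=> d1; rewrite ler_pdivrMr; last by lra.
  apply: (le_trans d1); rewrite /u.
  by rewrite mulrAC ler_pdivlMr// mul1r mulrC ler_pdivlMr.
have kV : kappa^-1 <= 8 / 7.
  rewrite kappaE invf_div ler_pdivrMr; lra.
have k_ge : 7 / 8 <= kappa.
  by rewrite kappaE ler_pdivlMr; lra.
have u1 : u <= 5 / 6.
  have s65 : 6 / 5 <= s.
    rewrite -(@ler_pXn2r _ 2)// ?nnegrE; [|lra|lra].
    rewrite expr_div_n; lra.
  by rewrite /u -[leLHS]mul1r ler_pdivrMr//; lra.
(* Everything becomes a multiple of u = 1/s, with 6.56 = 4 * 1.64. The bounds kappa >= 7/8, 1/kappa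
   <= 8/7 and u <= 5/6 come from n >= 7. *)
have -> : 164 / 100 * n / s ^+ 3 + 2 / s = u * (2 + 656 / 100 * kappa).
  by rewrite /u kappaE; field.
have -> : ((1 + kappa) / kappa + (3 / 2 + 2 / s) + 2 * (1 + kappa)) / (2 * s) =
    u * (9 / 4 + kappa^-1 / 2 + u + kappa).
  by rewrite /u; field; rewrite sn0 gt_eqF.
have -> : 1 / (2 * s) = u / 2 by rewrite /u; field.
have : u * (9 / 4 + kappa^-1 / 2 + u + kappa) <=
    u * (1 / 4 + 656 / 100 * kappa) by rewrite ler_pM2l//; lra.
lra.
Qed.

Theorem theorem3p3 (R : realType) (m : nat) (hn : (7 <= 2 * m + 1)%N) (z : R) :
  let n : R := (2 * m + 1)%:R in
  let sigma : R := Num.sqrt (sigmaV2 m) in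
  `| Prob (fun w : omega m => ((Vtot w)%:R - n / 2) / sigma <= z) - Phi z |
    <= n / (2 * sigma ^+ 2) * Delta1 m + 164 / 100 * n / sigma ^+ 3 + 2 / sigma.
Proof.
rewrite /=; set n : R := (2 * m + 1)%:R.
have m3 : (3 <= m)%N by lia.
have /andP[v_ge v_le] := @sigmaV2_bounds R m (ltac:(lia)).
rewrite -/n in v_ge v_le.
have n7 : 7 <= n by rewrite ler_nat.
have v0 : 0 < sigmaV2 m :> R by lra.
set s := Num.sqrt _.
have s0 : 0 < s by rewrite sqrtr_gt0.
have s2 : s ^+ 2 = sigmaV2 m by rewrite sqr_sqrtr ?ltW.
pose kappa := n / (4 * s ^+ 2).
have k0 : 0 < kappa by rewrite divr_gt0// ?mulr_gt0 ?exprn_gt0//; lra.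
have tv := @lightbulb_total_variation R m (fun k => (k%:R - n / 2) / s <= z).
have := @fair_coins_normal R 'I_(2 * m + 1) s kappa z s0 k0.
rewrite !card_ord -/n => /(_ erefl) normal.
have := @numeric_bound R m n s kappa m3 s0 erefl erefl.
rewrite s2 v_ge v_le -s2 => /(_ isT) num.
have D0 : 0 <= n / (2 * s ^+ 2) * Delta1 m.
  rewrite mulr_ge0 ?divr_ge0 ?mulr_ge0 ?exprn_ge0 ?(ltW s0) ?ler0n//.
  by rewrite /Delta1 addr_ge0 ?mulr_ge0 ?divr_ge0 ?mulr_ge0 ?sqrtr_ge0 ?expR_ge0.
(* Triangle inequality through the binomial law: [num] fits both errors into the last two terms of
   the bound, and [D0] allows adding the first. *)
rewrite -addrA; apply: (le_trans (le_trans _ num)); last by rewrite lerDr.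
apply: le_trans (lerD tv normal).
by rewrite (le_trans _ (ler_normD _ _))// addrA subrK.
Qed.
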